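(* Let $X=c_0(\mathbb{Z})$ or $X=\ell_p(\mathbb{Z})$ for some $p\in[1,\infty)$. There exists a bounded sequence $w=(w_j)_{j\in\mathbb{Z}}$ of scalars, with $\inf_{j\in\mathbb{Z}}|w_j|>0$, such that the bilateral weighted backward shift $B_w:X\to X$, $B_w((x_j)_{j\in\mathbb{Z}})=(w_{j+1}x_{j+1})_{j\in\mathbb{Z}}$, is topologically transitive and both $B_w$ and $B_w^{-1}$ are average positively expansive and distributionally chaotic.
   Context: Scalars are in $\mathbb{K}=\mathbb{R}$ or $\mathbb{C}$; $\mathbb{N}=\{1,2,3,\dots\}$ and $\mathbb{N}_0=\mathbb{N}\cup\{0\}$. $c_0(\mathbb{Z})$ is the Banach space (sup norm) of scalar families $(x_j)_{j\in\mathbb{Z}}$ with $x_j\to0$ as $|j|\to\infty$, and $\ell_p(\mathbb{Z})$ is the usual Banach space of $p$-summable scalar families. Let $T$ be a continuous linear operator on a Banach space $X$. $T$ is topologically transitive if for any pair $A,B$ of nonempty open sets in $X$ there exists $n\in\mathbb{N}_0$ such that $T^n(A)\cap B\ne\emptyset$. $T$ is average positively expansive if for each $x\in X\setminus\{0\}$, $\sup_{n\in\mathbb{N}}\big(\frac1n\sum_{j=0}^{n-1}\|T^jx\|\big)=\infty$. The upper density of $A\subset\mathbb{N}$ is $\overline{\mathrm{dens}}(A)=\limsup_{n\to\infty}\frac{\mathrm{card}(A\cap[1,n])}{n}$. $T$ is distributionally chaotic if there exist an uncountable set $\Gamma\subset X$ and $\varepsilon>0$ such that for every pair $(x,y)$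 of distinct points of $\Gamma$, $\overline{\mathrm{dens}}\{n\in\mathbb{N}:\|T^nx-T^ny\|\ge\varepsilon\}=1$ and $\overline{\mathrm{dens}}\{n\in\mathbb{N}:\|T^nx-T^ny\|<\tau\}=1$ for all $\tau>0$. *)

(* Defs.v *)
From Stdlib Require Export Reals.
From Stdlib Require Import ZArith List Lra Lia.
From Stdlib Require Import ClassicalEpsilon FunctionalExtensionality ProofIrrelevance.
From Coquelicot Require Export Coquelicot.

Open Scope R_scope.

Record operator {K : AbsRing} (X : NormedModule K) := Operator {
  op_fun :> X -> X;
  op_is_linear : is_linear op_fun (* Coquelicot's [is_linear] includes boundedness *)
}.

Arguments Operator {K X} _ _.

Section Dynamics.

Context {K : AbsRing} {X : NormedModule K}.
Implicit Types T S : operator X.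

Definition orbit T (x : X) (n : nat) : X := Nat.iter n T x.

Definition is_inverse T S : Prop :=
  (forall x, S (T x) = x) /\ (forall x, T (S x) = x).

Definition topologically_transitive T : Prop :=
  forall A B : X -> Prop,
    open A -> open B -> (exists a, A a) -> (exists b, B b) ->
    exists n : nat, exists x : X, A x /\ B (orbit T x n).

Definition orbit_average T (x : X) (n : nat) : R :=
  sum_n (fun j => norm (orbit T x j)) (n - 1) / INR n.

Definition average_positively_expansive T : Prop :=
  forall x : X, x <> zero ->
    Lub_Rbar (fun r => exists n : nat, (1 <= n)%nat /\ r = orbit_average T x n)
      = p_infty.

Definition uncountable (G : X -> Prop) : Prop :=
  ~ exists f : X -> nat, forall x y, G x -> G y -> f x = f y -> x = y.

Definition count (A : nat -> Prop) (n : nat) : nat :=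
  length (filter (fun k => if excluded_middle_informative (A k) then true else false)
                 (seq 1 n)).

Definition upper_density (A : nat -> Prop) : Rbar :=
  LimSup_seq (fun n => INR (count A n) / INR n).

Definition distributionally_chaotic T : Prop :=
  exists (G : X -> Prop) (eps : R),
    uncountable G /\ 0 < eps /\
    forall x y : X, G x -> G y -> x <> y ->
      upper_density (fun n => norm (minus (orbit T x n) (orbit T y n)) >= eps)
        = Finite 1 /\
      forall tau : R, 0 < tau ->
        upper_density (fun n => norm (minus (orbit T x n) (orbit T y n)) < tau)
          = Finite 1.

End Dynamics.

Definition zpos (a : Z -> R) (n : nat) : R := a (Z.of_nat n).
Definition zneg (a : Z -> R) (n : nat) : R := a (- Z.of_nat (S n))%Z.

(* Only used for nonnegative families, for which these agree with unordered
   summability and the unordered sum. *)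
Definition ex_zseries (a : Z -> R) : Prop := ex_series (zpos a) /\ ex_series (zneg a).
Definition zseries (a : Z -> R) : R := Series (zpos a) + Series (zneg a).

Lemma ex_zseries_le (a b : Z -> R) :
  (forall j, 0 <= a j <= b j) -> ex_zseries b -> ex_zseries a.
Proof.
intros H [H1 H2]; split.
- apply (ex_series_le (V := R_CompleteNormedModule) (zpos a) (zpos b)); [|exact H1]; intro n; unfold zpos.
  change (Rabs (a (Z.of_nat n)) <= b (Z.of_nat n)).
  rewrite Rabs_pos_eq; apply H.
- apply (ex_series_le (V := R_CompleteNormedModule) (zneg a) (zneg b)); [|exact H2]; intro n; unfold zneg.
  change (Rabs (a (- Z.of_nat (S n))%Z) <= b (- Z.of_nat (S n))%Z).
  rewrite Rabs_pos_eq; apply H.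
Qed.

Lemma zseries_le (a b : Z -> R) :
  (forall j, 0 <= a j <= b j) -> ex_zseries b -> zseries a <= zseries b.
Proof.
intros H [H1 H2]; unfold zseries.
apply Rplus_le_compat; apply Series_le; auto; intro n; apply H.
Qed.

Lemma ex_zseries_plus (a b : Z -> R) :
  ex_zseries a -> ex_zseries b -> ex_zseries (fun j => a j + b j).
Proof.
intros [H1 H2] [H3 H4]; split.
- exact (ex_series_plus (zpos a) (zpos b) H1 H3).
- exact (ex_series_plus (zneg a) (zneg b) H2 H4).
Qed.

Lemma zseries_plus (a b : Z -> R) :
  ex_zseries a -> ex_zseries b ->
  zseries (fun j => a j + b j) = zseries a + zseries b.
Proof.
intros [H1 H2] [H3 H4]; unfold zseries.
change (zpos (fun j => a j + b j)) with (fun n => zpos a n + zpos b n).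
change (zneg (fun j => a j + b j)) with (fun n => zneg a n + zneg b n).
rewrite !Series_plus; auto; ring.
Qed.

Lemma ex_zseries_scal (c : R) (a : Z -> R) :
  ex_zseries a -> ex_zseries (fun j => c * a j).
Proof.
intros [H1 H2]; split.
- exact (ex_series_scal c (zpos a) H1).
- exact (ex_series_scal c (zneg a) H2).
Qed.

Lemma zseries_scal (c : R) (a : Z -> R) :
  zseries (fun j => c * a j) = c * zseries a.
Proof.
unfold zseries.
change (zpos (fun j => c * a j)) with (fun n => c * zpos a n).
change (zneg (fun j => c * a j)) with (fun n => c * zneg a n).
rewrite !Series_scal_l; ring.
Qed.

Lemma Series_nonneg (a : nat -> R) : (forall n, 0 <= a n) -> ex_series a -> 0 <= Series a.
Proof.
intros H Ha.
assert (Series (fun _ : nat => 0 * 0) <= Series a).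
{ apply Series_le; auto; intro n; rewrite Rmult_0_l; split; [lra|apply H]. }
rewrite Series_scal_l, Rmult_0_l in H0; exact H0.
Qed.

Lemma Series_term_le (a : nat -> R) (k : nat) :
  (forall n, 0 <= a n) -> ex_series a -> a k <= Series a.
Proof.
revert a; induction k as [|k IH]; intros a H Ha;
  rewrite Series_incr_1 by exact Ha;
  assert (Ha' : ex_series (fun n => a (S n))) by (apply ex_series_incr_1 in Ha; exact Ha).
- assert (0 <= Series (fun n => a (S n))) by (apply Series_nonneg; auto); lra.
- specialize (IH (fun n => a (S n)) (fun n => H (S n)) Ha'); simpl in IH.
  specialize (H 0%nat); lra.
Qed.

Lemma zseries_nonneg (a : Z -> R) : (forall j, 0 <= a j) -> ex_zseries a -> 0 <= zseries a.
Proof.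
intros H [H1 H2]; apply Rplus_le_le_0_compat; apply Series_nonneg; auto; intro; apply H.
Qed.

Lemma zseries_term_le (a : Z -> R) (j : Z) :
  (forall i, 0 <= a i) -> ex_zseries a -> a j <= zseries a.
Proof.
intros H [H1 H2]; unfold zseries.
assert (0 <= Series (zpos a)) by (apply Series_nonneg; auto; intro; apply H).
assert (0 <= Series (zneg a)) by (apply Series_nonneg; auto; intro; apply H).
destruct (Z_le_dec 0 j) as [Hj|Hj].
- assert (zpos a (Z.to_nat j) <= Series (zpos a))
    by (apply Series_term_le; auto; intro; apply H).
  unfold zpos at 1 in H4; rewrite Z2Nat.id in H4 by lia; lra.
- assert (zneg a (Z.to_nat (- j - 1)) <= Series (zneg a))
    by (apply Series_term_le; auto; intro; apply H).
  unfold zneg at 1 in H4.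
  replace (- Z.of_nat (S (Z.to_nat (- j - 1))))%Z with j in H4 by lia; lra.
Qed.

Lemma zseries_shift (a : Z -> R) :
  ex_zseries a ->
  ex_zseries (fun j => a (j + 1)%Z) /\ zseries (fun j => a (j + 1)%Z) = zseries a.
Proof.
intros [H1 H2].
assert (E1 : zpos (fun j => a (j + 1)%Z) = fun n => zpos a (S n)).
{ extensionality n; unfold zpos; f_equal; lia. }
set (g := zneg (fun j => a (j + 1)%Z)).
assert (E2 : zneg a = fun n => g (S n)).
{ extensionality n; unfold g, zneg; f_equal; lia. }
assert (Hg : ex_series g).
{ rewrite E2 in H2; apply (proj2 (ex_series_incr_1 g)); exact H2. }
assert (Hp : ex_series (fun n => zpos a (S n))).
{ apply (proj1 (ex_series_incr_1 (zpos a))); exact H1. }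
split.
- split; [rewrite E1; exact Hp|exact Hg].
- unfold zseries; fold g; rewrite E1, E2, (Series_incr_1 _ Hg), (Series_incr_1 _ H1).
  assert (E : g 0%nat = zpos a 0) by (unfold g, zneg, zpos; f_equal; lia).
  rewrite E; ring.
Qed.

(* [Rpower 0 p] is [1] in the standard library. *)
Definition rpow (t p : R) : R := if Rlt_dec 0 t then Rpower t p else 0.

Lemma rpow_pos t p : 0 < t -> rpow t p = Rpower t p.
Proof. intro; unfold rpow; destruct Rlt_dec; lra. Qed.

Lemma rpow_0 p : rpow 0 p = 0.
Proof. unfold rpow; destruct Rlt_dec; lra. Qed.

Lemma rpow_nonneg t p : 0 <= rpow t p.
Proof. unfold rpow; destruct Rlt_dec; [left; apply exp_pos|lra]. Qed.

Lemma rpow_gt0 t p : 0 < t -> 0 < rpow t p.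
Proof. intro; rewrite rpow_pos by auto; apply exp_pos. Qed.

Lemma rpow_mult s t p : 0 <= s -> 0 <= t -> rpow (s * t) p = rpow s p * rpow t p.
Proof.
intros [Hs|<-] [Ht|<-]; rewrite ?Rmult_0_l, ?Rmult_0_r, ?rpow_0; try ring.
rewrite !rpow_pos by (auto; apply Rmult_lt_0_compat; auto).
symmetry; apply Rpower_mult_distr; auto.
Qed.

Lemma rpow_le s t p : 0 <= p -> 0 <= s <= t -> rpow s p <= rpow t p.
Proof.
intros Hp [[Hs|<-] Ht]; [|rewrite rpow_0; apply rpow_nonneg].
rewrite !rpow_pos by lra; apply Rle_Rpower_l; lra.
Qed.

Lemma rpow_rpow t p q : 0 <= t -> rpow (rpow t p) q = rpow t (p * q).
Proof.
intros [Ht|<-]; [|rewrite !rpow_0; reflexivity].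
rewrite !(rpow_pos t), rpow_pos by (auto; apply exp_pos); apply Rpower_mult.
Qed.

Lemma rpow_1 t : 0 <= t -> rpow t 1 = t.
Proof. intros [Ht|<-]; [rewrite rpow_pos, Rpower_1; auto|apply rpow_0]. Qed.

Lemma rpow_base1 p : rpow 1 p = 1.
Proof. rewrite rpow_pos by lra; unfold Rpower; rewrite ln_1, Rmult_0_r; apply exp_0. Qed.

Lemma rpow_bernoulli t p : 1 <= p -> 0 <= t -> 1 + p * (t - 1) <= rpow t p.
Proof.
intros Hp [Ht|<-]; [|rewrite rpow_0; lra].
rewrite rpow_pos by auto; unfold Rpower.
assert (B : forall y, 1 + y <= exp y).
{ intro y; destruct (Req_dec y 0) as [->|Hy]; [rewrite exp_0; lra|].
  left; apply exp_ineq1; exact Hy. }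
set (u := ln t).
assert (Et : t = exp u) by (unfold u; rewrite exp_ln; auto).
assert (H1 := B (p * u - u)); assert (H2 := B (- u)).
assert (E1 : exp (p * u) = exp u * exp (p * u - u))
  by (rewrite <- exp_plus; f_equal; ring).
assert (E2 : 1 = exp u * exp (- u))
  by (rewrite <- exp_plus, Rplus_opp_r, exp_0; reflexivity).
assert (H3 : exp u * (1 + (p * u - u)) <= exp (p * u))
  by (rewrite E1; apply Rmult_le_compat_l; [left; apply exp_pos|auto]).
assert (H4 : exp u * (1 + - u) <= 1)
  by (rewrite E2 at 2; apply Rmult_le_compat_l; [left; apply exp_pos|auto]).
rewrite Et at 1.
assert (0 <= (p - 1) * (exp u * u - exp u + 1)) by (apply Rmult_le_pos; lra).
lra.
Qed.

Lemma rpow_convex (a b s t p : R) :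
  1 <= p -> 0 < a -> 0 < b -> 0 <= s -> 0 <= t ->
  rpow (s + t) p <=
    rpow (a + b) p * (a / (a + b) * rpow (s / a) p + b / (a + b) * rpow (t / b) p).
Proof.
intros Hp Ha Hb Hs Ht.
assert (Hab : 0 < a + b) by lra.
set (l := a / (a + b)); set (m := b / (a + b)).
assert (Hl : 0 < l) by (apply Rdiv_lt_0_compat; auto).
assert (Hm : 0 < m) by (apply Rdiv_lt_0_compat; auto).
assert (Hlm : l + m = 1) by (unfold l, m; field; lra).
assert (HU : 0 <= s / a) by (apply Rdiv_le_0_compat; auto).
assert (HV : 0 <= t / b) by (apply Rdiv_le_0_compat; auto).
assert (E : s + t = (a + b) * (l * (s / a) + m * (t / b))) by (unfold l, m; field; lra).
set (U := s / a) in *; set (V := t / b) in *.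
assert (HW : 0 <= l * U + m * V) by nra.
rewrite E, rpow_mult by lra.
apply Rmult_le_compat_l; [apply rpow_nonneg|].
destruct HW as [HW|HW].
2:{ rewrite <- HW, rpow_0; assert (H1 := rpow_nonneg U p); assert (H2 := rpow_nonneg V p); nra. }
set (W := l * U + m * V) in *.
assert (T : forall x, 0 <= x -> rpow W p * (1 + p * (x / W - 1)) <= rpow x p).
{ intros x Hx.
  replace (rpow x p) with (rpow W p * rpow (x / W) p).
  - apply Rmult_le_compat_l; [apply rpow_nonneg|].
    apply rpow_bernoulli; auto; apply Rdiv_le_0_compat; lra.
  - rewrite <- rpow_mult; [f_equal; field; lra|lra|apply Rdiv_le_0_compat; auto]. }
assert (TU := T U HU); assert (TV := T V HV).
assert (EW : l * (1 + p * (U / W - 1)) + m * (1 + p * (V / W - 1)) = 1).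
{ replace (l * (1 + p * (U / W - 1)) + m * (1 + p * (V / W - 1)))
    with ((l + m) + p * ((l * U + m * V) / W - (l + m))) by (field; lra).
  fold W; rewrite Hlm; field; lra. }
assert (l * (rpow W p * (1 + p * (U / W - 1))) <= l * rpow U p)
  by (apply Rmult_le_compat_l; lra).
assert (m * (rpow W p * (1 + p * (V / W - 1))) <= m * rpow V p)
  by (apply Rmult_le_compat_l; lra).
replace (rpow W p) with
  (rpow W p * (l * (1 + p * (U / W - 1)) + m * (1 + p * (V / W - 1))))
  by (rewrite EW; ring).
lra.
Qed.

Inductive seqspace : Type :=
  | c0Z : seqspace
  | lpZ (p : R) (Hp : 1 <= p) : seqspace.

Lemma opp_sub {G : AbelianGroup} (a b : G) : opp (plus a (opp b)) = plus b (opp a).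
Proof. rewrite opp_plus, opp_opp; apply plus_comm. Qed.

Lemma sub_telescope {G : AbelianGroup} (a b c : G) :
  plus (plus b (opp a)) (plus c (opp b)) = plus c (opp a).
Proof.
rewrite (plus_comm (plus b _)), <- plus_assoc, (plus_assoc (opp b)), plus_opp_l, plus_zero_l.
reflexivity.
Qed.

Section SequenceSpaces.

Context {K : AbsRing}.

Definition in_space (E : seqspace) (x : Z -> K) : Prop :=
  match E with
  | c0Z => forall eps : R, 0 < eps ->
             exists N : Z, forall j : Z, (N <= Z.abs j)%Z -> abs (x j) < eps
  | lpZ p _ => ex_zseries (fun j => rpow (abs (x j)) p)
  end.

Definition space_norm (E : seqspace) (x : Z -> K) : R :=
  match E with
  | c0Z => real (Lub_Rbar (fun r => exists j : Z, r = abs (x j)))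
  | lpZ p _ => rpow (zseries (fun j => rpow (abs (x j)) p)) (/ p)
  end.

Lemma c0_bounded (x : Z -> K) : in_space c0Z x -> exists M, forall j, abs (x j) <= M.
Proof.
intro H; destruct (H 1 Rlt_0_1) as [N HN].
assert (F : forall n : nat, exists M, forall j, (Z.abs j < Z.of_nat n)%Z -> abs (x j) <= M).
{ induction n as [|n [M HM]].
  - exists 0; intros j Hj; lia.
  - exists (Rmax M (Rmax (abs (x (Z.of_nat n))) (abs (x (- Z.of_nat n)%Z)))).
    intros j Hj.
    destruct (Z.eq_dec (Z.abs j) (Z.of_nat n)) as [e|e].
    + eapply Rle_trans; [|apply Rmax_r].
      assert (D : j = Z.of_nat n \/ j = (- Z.of_nat n)%Z) by lia.
      destruct D as [->| ->]; [apply Rmax_l|apply Rmax_r].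
    + eapply Rle_trans; [apply HM; lia|apply Rmax_l]. }
destruct (F (Z.to_nat N)) as [M HM].
exists (Rmax M 1); intro j.
destruct (Z_lt_dec (Z.abs j) N) as [h|h].
- eapply Rle_trans; [apply HM; lia|apply Rmax_l].
- eapply Rle_trans; [left; apply HN; lia|apply Rmax_r].
Qed.

Lemma c0_norm_ub (x : Z -> K) j : in_space c0Z x -> abs (x j) <= space_norm c0Z x.
Proof.
intro H; destruct (c0_bounded x H) as [M HM]; simpl.
destruct (Lub_Rbar_correct (fun r => exists j : Z, r = abs (x j))) as [U L].
assert (LM := L (Finite M)).
specialize (U (abs (x j)) (ex_intro _ j eq_refl)).
destruct (Lub_Rbar _) as [l| |]; simpl in *; try easy.
exfalso; apply LM; intros r [i ->]; apply HM.
Qed.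

Lemma c0_norm_lub (x : Z -> K) M :
  (forall j, abs (x j) <= M) -> space_norm c0Z x <= M.
Proof.
intro H; simpl.
destruct (Lub_Rbar_correct (fun r => exists j : Z, r = abs (x j))) as [U L].
specialize (U (abs (x 0%Z)) (ex_intro _ 0%Z eq_refl)).
assert (LM : Rbar_le (Lub_Rbar (fun r => exists j : Z, r = abs (x j))) M)
  by (apply L; intros r [i ->]; apply H).
destruct (Lub_Rbar _) as [l| |]; simpl in *; easy.
Qed.

Lemma space_norm_nonneg E (x : Z -> K) : in_space E x -> 0 <= space_norm E x.
Proof.
destruct E as [|p Hp]; intro H.
- eapply Rle_trans; [apply (abs_ge_0 (x 0%Z))|apply c0_norm_ub, H].
- apply rpow_nonneg.
Qed.

Lemma lp_sum_le p Hp (x : Z -> K) a : 0 <= a ->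
  space_norm (lpZ p Hp) x <= a -> in_space (lpZ p Hp) x ->
  zseries (fun j => rpow (abs (x j)) p) <= rpow a p.
Proof.
simpl; intros Ha H Hx.
assert (0 <= zseries (fun j => rpow (abs (x j)) p))
  by (apply zseries_nonneg; auto; intro; apply rpow_nonneg).
replace (zseries (fun j => rpow (abs (x j)) p))
  with (rpow (rpow (zseries (fun j => rpow (abs (x j)) p)) (/ p)) p).
- apply rpow_le; [lra|split; [apply rpow_nonneg|auto]].
- rewrite rpow_rpow by auto; rewrite Rinv_l by lra; apply rpow_1; auto.
Qed.

Lemma lp_norm_le p Hp (x : Z -> K) a : 0 <= a -> in_space (lpZ p Hp) x ->
  zseries (fun j => rpow (abs (x j)) p) <= rpow a p ->
  space_norm (lpZ p Hp) x <= a.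
Proof.
simpl; intros Ha Hx H.
assert (0 <= zseries (fun j => rpow (abs (x j)) p))
  by (apply zseries_nonneg; auto; intro; apply rpow_nonneg).
replace a with (rpow (rpow a p) (/ p)).
- apply rpow_le; [|split; auto]; left; apply Rinv_0_lt_compat; lra.
- rewrite rpow_rpow by auto; rewrite Rinv_r by lra; apply rpow_1; auto.
Qed.

Lemma lp_plus_aux p (Hp : 1 <= p) (x y : Z -> K) a b :
  0 < a -> 0 < b -> in_space (lpZ p Hp) x -> in_space (lpZ p Hp) y ->
  in_space (lpZ p Hp) (fun j => plus (x j) (y j)) /\
  zseries (fun j => rpow (abs (plus (x j) (y j))) p) <=
    rpow (a + b) p *
      (a / (a + b) * (/ rpow a p * zseries (fun j => rpow (abs (x j)) p)) +
       b / (a + b) * (/ rpow b p * zseries (fun j => rpow (abs (y j)) p))).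
Proof.
simpl; intros Ha Hb Hx Hy.
set (ca := a / (a + b) * / rpow a p); set (cb := b / (a + b) * / rpow b p).
set (g := fun j => rpow (a + b) p *
  (ca * rpow (abs (x j)) p + cb * rpow (abs (y j)) p)).
assert (D : forall c t, 0 < c -> 0 <= t -> rpow (t / c) p = / rpow c p * rpow t p).
{ intros c t Hc Ht; assert (P := rpow_gt0 c p Hc).
  assert (E : rpow t p = rpow (t / c) p * rpow c p).
  { rewrite <- rpow_mult; [f_equal; field; lra|apply Rdiv_le_0_compat; auto|lra]. }
  rewrite E; field; lra. }
assert (G : forall j, 0 <= rpow (abs (plus (x j) (y j))) p <= g j).
{ intro j; split; [apply rpow_nonneg|].
  eapply Rle_trans.
  - apply rpow_le; [lra|split; [apply abs_ge_0|apply abs_triangle]].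
  - eapply Rle_trans; [apply (rpow_convex a b); auto; apply abs_ge_0|].
    rewrite !D by (auto; apply abs_ge_0); unfold g, ca, cb; right; ring. }
assert (Gx : ex_zseries g).
{ apply ex_zseries_scal, ex_zseries_plus; apply ex_zseries_scal; auto. }
split; [exact (ex_zseries_le _ g G Gx)|].
eapply Rle_trans; [apply (zseries_le _ g G Gx)|].
unfold g; rewrite zseries_scal, zseries_plus, !zseries_scal
  by (apply ex_zseries_scal; auto).
unfold ca, cb; right; ring.
Qed.

Lemma in_space_plus E (x y : Z -> K) :
  in_space E x -> in_space E y -> in_space E (fun j => plus (x j) (y j)).
Proof.
destruct E as [|p Hp]; intros Hx Hy.
- intros eps He.
  destruct (Hx (eps / 2)) as [N1 H1]; [lra|].
  destruct (Hy (eps / 2)) as [N2 H2]; [lra|].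
  exists (Z.max N1 N2); intros j Hj.
  eapply Rle_lt_trans; [apply abs_triangle|].
  specialize (H1 j ltac:(lia)); specialize (H2 j ltac:(lia)); lra.
- exact (proj1 (lp_plus_aux p Hp x y 1 1 Rlt_0_1 Rlt_0_1 Hx Hy)).
Qed.

Lemma space_norm_triangle E (x y : Z -> K) :
  in_space E x -> in_space E y ->
  space_norm E (fun j => plus (x j) (y j)) <= space_norm E x + space_norm E y.
Proof.
intros Hx Hy; destruct E as [|p Hp].
- apply c0_norm_lub; intro j; eapply Rle_trans; [apply abs_triangle|].
  apply Rplus_le_compat; apply c0_norm_ub; auto.
- apply le_epsilon; intros e He.
  assert (Nx := space_norm_nonneg _ _ Hx); assert (Ny := space_norm_nonneg _ _ Hy).
  set (a := space_norm (lpZ p Hp) x + e / 2).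
  set (b := space_norm (lpZ p Hp) y + e / 2).
  assert (Ha : 0 < a) by (unfold a; lra); assert (Hb : 0 < b) by (unfold b; lra).
  replace (_ + e) with (a + b) by (unfold a, b; lra).
  destruct (lp_plus_aux p Hp x y a b Ha Hb Hx Hy) as [S1 S2].
  apply lp_norm_le; [lra|exact S1|].
  eapply Rle_trans; [exact S2|].
  rewrite <- (Rmult_1_r (rpow (a + b) p)) at 2.
  apply Rmult_le_compat_l; [apply rpow_nonneg|].
  assert (F : forall c z, 0 < c -> in_space (lpZ p Hp) z -> space_norm (lpZ p Hp) z <= c ->
    / rpow c p * zseries (fun j => rpow (abs (z j)) p) <= 1).
  { intros c z Hc Hz Hn; assert (P := rpow_gt0 c p Hc).
    apply (Rmult_le_reg_l (rpow c p)); [exact P|].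
    rewrite <- Rmult_assoc, Rinv_r, Rmult_1_l, Rmult_1_r by lra.
    apply (lp_sum_le p Hp); auto; lra. }
  assert (Fx := F a x Ha Hx ltac:(unfold a; lra)).
  assert (Fy := F b y Hb Hy ltac:(unfold b; lra)).
  assert (0 < a / (a + b)) by (apply Rdiv_lt_0_compat; lra).
  assert (0 < b / (a + b)) by (apply Rdiv_lt_0_compat; lra).
  assert (a / (a + b) + b / (a + b) = 1) by (field; lra).
  nra.
Qed.

Lemma in_space_bmult E (w x : Z -> K) M : 0 <= M -> (forall j, abs (w j) <= M) ->
  in_space E x ->
  in_space E (fun j => mult (w j) (x j)) /\
  space_norm E (fun j => mult (w j) (x j)) <= M * space_norm E x.
Proof.
intros HM Hw Hx.
assert (B : forall j, abs (mult (w j) (x j)) <= M * abs (x j)).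
{ intro j; eapply Rle_trans; [apply abs_mult|].
  apply Rmult_le_compat_r; [apply abs_ge_0|apply Hw]. }
destruct E as [|p Hp].
- split.
  + intros eps He; destruct (Hx (eps / (M + 1))) as [N HN].
    { apply Rdiv_lt_0_compat; lra. }
    exists N; intros j Hj; specialize (HN j Hj); specialize (B j).
    eapply Rle_lt_trans; [exact B|].
    assert (A := abs_ge_0 (x j)).
    apply (Rmult_lt_compat_l (M + 1)) in HN; [|lra].
    replace ((M + 1) * (eps / (M + 1))) with eps in HN by (field; lra); lra.
  + apply c0_norm_lub; intro j; eapply Rle_trans; [apply B|].
    apply Rmult_le_compat_l; auto; apply c0_norm_ub; auto.
- set (g := fun j => rpow M p * rpow (abs (x j)) p).
  assert (G : forall j, 0 <= rpow (abs (mult (w j) (x j))) p <= g j).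
  { intro j; split; [apply rpow_nonneg|]; unfold g.
    rewrite <- rpow_mult by (auto; apply abs_ge_0).
    apply rpow_le; [lra|split; [apply abs_ge_0|apply B]]. }
  assert (Gx : ex_zseries g) by (apply ex_zseries_scal; exact Hx).
  assert (S1 := ex_zseries_le _ g G Gx).
  split; [exact S1|].
  assert (Nx := space_norm_nonneg _ _ Hx).
  apply lp_norm_le; [nra|exact S1|].
  eapply Rle_trans; [apply (zseries_le _ g G Gx)|].
  unfold g; rewrite zseries_scal, rpow_mult by auto.
  apply Rmult_le_compat_l; [apply rpow_nonneg|].
  apply (lp_sum_le p Hp); auto; lra.
Qed.

Lemma in_space_zero E : in_space E (fun _ => @zero K).
Proof.
destruct E as [|p Hp].
- intros eps He; exists 0%Z; intros; rewrite abs_zero; exact He.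
- assert (Z : ex_series (fun _ : nat => 0)) by
    (exists 0; apply (is_series_ext (fun _ => scal 0 0));
     [intro; apply (scal_zero_l (V := R_ModuleSpace))|];
     apply filterlim_ext with (fun _ : nat => 0);
     [intro n; rewrite sum_n_const; simpl; unfold scal; simpl; unfold mult; simpl; ring
     |apply filterlim_const]).
  split; unfold zpos, zneg; rewrite abs_zero, rpow_0; exact Z.
Qed.

Lemma in_space_shift E (x : Z -> K) : in_space E x ->
  in_space E (fun j => x (j + 1)%Z) /\
  space_norm E (fun j => x (j + 1)%Z) <= space_norm E x.
Proof.
intro Hx; destruct E as [|p Hp].
- split.
  + intros eps He; destruct (Hx eps He) as [N HN].
    exists (N + 1)%Z; intros j Hj; apply HN; lia.
  + apply c0_norm_lub; intro j; apply (c0_norm_ub x (j + 1)%Z); auto.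
- destruct (zseries_shift (fun j => rpow (abs (x j)) p) Hx) as [S1 S2].
  split; [exact S1|]; simpl; rewrite S2; lra.
Qed.

Lemma space_norm_eq0 E (x : Z -> K) : in_space E x -> space_norm E x = 0 ->
  forall j, x j = zero.
Proof.
intros Hx H j; apply abs_eq_zero; apply Rle_antisym; [|apply abs_ge_0].
destruct E as [|p Hp].
- rewrite <- H; apply c0_norm_ub; auto.
- assert (S := lp_sum_le p Hp x 0 (Rle_refl 0) (Req_le _ _ H) Hx).
  rewrite rpow_0 in S.
  assert (T := zseries_term_le (fun j => rpow (abs (x j)) p) j
                (fun i => rpow_nonneg _ _) Hx); simpl in T.
  destruct (abs_ge_0 (x j)) as [P|P]; [|lra].
  assert (Q := rpow_gt0 _ p P); lra.
Qed.

Variable E : seqspace.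

Definition seqs : Type := { x : Z -> K | in_space E x }.
Definition coord (x : seqs) : Z -> K := proj1_sig x.

Lemma seqs_ext (x y : seqs) : (forall j, coord x j = coord y j) -> x = y.
Proof.
destruct x as [x Hx], y as [y Hy]; unfold coord; simpl; intro H.
assert (e : x = y) by (extensionality j; apply H).
subst y; f_equal; apply proof_irrelevance.
Qed.

Lemma in_space_scal (k : K) (x : Z -> K) : in_space E x ->
  in_space E (fun j => mult k (x j)).
Proof. intro H; apply (in_space_bmult E (fun _ => k) x (abs k)); auto using abs_ge_0, Rle_refl. Qed.

Lemma in_space_opp (x : Z -> K) : in_space E x -> in_space E (fun j => opp (x j)).
Proof.
intro H; replace (fun j => opp (x j)) with (fun j => mult (opp one) (x j)).
- apply in_space_scal; exact H.
- extensionality j; rewrite <- opp_mult_l, mult_one_l; reflexivity.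
Qed.

Definition seqs_zero : seqs := exist _ _ (in_space_zero E).
Definition seqs_plus (x y : seqs) : seqs :=
  exist _ (fun j => plus (coord x j) (coord y j))
    (in_space_plus E _ _ (proj2_sig x) (proj2_sig y)).
Definition seqs_opp (x : seqs) : seqs :=
  exist _ (fun j => opp (coord x j)) (in_space_opp _ (proj2_sig x)).
Definition seqs_scal (k : K) (x : seqs) : seqs :=
  exist _ (fun j => mult k (coord x j)) (in_space_scal k _ (proj2_sig x)).
Definition seqs_norm (x : seqs) : R := space_norm E (coord x).
Definition seqs_ball (x : seqs) (e : R) (y : seqs) : Prop :=
  seqs_norm (seqs_plus y (seqs_opp x)) < e.

Lemma seqs_plus_comm x y : seqs_plus x y = seqs_plus y x.
Proof. apply seqs_ext; intro j; exact (plus_comm (coord x j) (coord y j)). Qed.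
Lemma seqs_plus_assoc x y z : seqs_plus x (seqs_plus y z) = seqs_plus (seqs_plus x y) z.
Proof. apply seqs_ext; intro j; exact (plus_assoc (coord x j) (coord y j) (coord z j)). Qed.
Lemma seqs_plus_zero x : seqs_plus x seqs_zero = x.
Proof. apply seqs_ext; intro j; exact (plus_zero_r (coord x j)). Qed.
Lemma seqs_plus_opp x : seqs_plus x (seqs_opp x) = seqs_zero.
Proof. apply seqs_ext; intro j; exact (plus_opp_r (coord x j)). Qed.
Lemma seqs_scal_assoc k l x : seqs_scal k (seqs_scal l x) = seqs_scal (mult k l) x.
Proof. apply seqs_ext; intro j; exact (mult_assoc k l (coord x j)). Qed.
Lemma seqs_scal_one x : seqs_scal one x = x.
Proof. apply seqs_ext; intro j; exact (mult_one_l (coord x j)). Qed.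
Lemma seqs_scal_distr_l k x y :
  seqs_scal k (seqs_plus x y) = seqs_plus (seqs_scal k x) (seqs_scal k y).
Proof. apply seqs_ext; intro j; exact (mult_distr_l k (coord x j) (coord y j)). Qed.
Lemma seqs_scal_distr_r k l x :
  seqs_scal (plus k l) x = seqs_plus (seqs_scal k x) (seqs_scal l x).
Proof. apply seqs_ext; intro j; exact (mult_distr_r k l (coord x j)). Qed.

Lemma seqs_norm_triangle x y : seqs_norm (seqs_plus x y) <= seqs_norm x + seqs_norm y.
Proof. exact (space_norm_triangle E _ _ (proj2_sig x) (proj2_sig y)). Qed.
Lemma seqs_norm_scal k x : seqs_norm (seqs_scal k x) <= abs k * seqs_norm x.
Proof.
apply (in_space_bmult E (fun _ => k)); auto using abs_ge_0, Rle_refl.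
exact (proj2_sig x).
Qed.
Lemma seqs_norm_eq0 x : seqs_norm x = 0 -> x = seqs_zero.
Proof.
intro H; apply seqs_ext; intro j; exact (space_norm_eq0 E _ (proj2_sig x) H j).
Qed.
Lemma seqs_norm_zero : seqs_norm seqs_zero = 0.
Proof.
apply Rle_antisym.
- replace seqs_zero with (seqs_scal zero seqs_zero).
  + eapply Rle_trans; [apply seqs_norm_scal|]; rewrite abs_zero; lra.
  + apply seqs_ext; intro j; exact (mult_zero_r zero).
- exact (space_norm_nonneg E _ (proj2_sig seqs_zero)).
Qed.
Lemma seqs_norm_opp_le x : seqs_norm (seqs_opp x) <= seqs_norm x.
Proof.
replace (seqs_opp x) with (seqs_scal (opp one) x).
- eapply Rle_trans; [apply seqs_norm_scal|].
  rewrite abs_opp_one; lra.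
- apply seqs_ext; intro j.
  change (mult (opp one) (coord x j) = opp (coord x j)).
  rewrite <- opp_mult_l, mult_one_l; reflexivity.
Qed.

Lemma seqs_ball_center x (e : posreal) : seqs_ball x e x.
Proof.
unfold seqs_ball; rewrite seqs_plus_opp, seqs_norm_zero; apply cond_pos.
Qed.
Lemma seqs_ball_sym x y e : seqs_ball x e y -> seqs_ball y e x.
Proof.
unfold seqs_ball; intro H; eapply Rle_lt_trans; [|exact H].
replace (seqs_plus x (seqs_opp y)) with (seqs_opp (seqs_plus y (seqs_opp x))).
- apply seqs_norm_opp_le.
- apply seqs_ext; intro j.
  exact (opp_sub (coord y j) (coord x j)).
Qed.
Lemma seqs_ball_triangle x y z e1 e2 :
  seqs_ball x e1 y -> seqs_ball y e2 z -> seqs_ball x (e1 + e2) z.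
Proof.
unfold seqs_ball; intros H1 H2.
replace (seqs_plus z (seqs_opp x)) with
  (seqs_plus (seqs_plus y (seqs_opp x)) (seqs_plus z (seqs_opp y))).
- eapply Rle_lt_trans; [apply seqs_norm_triangle|lra].
- apply seqs_ext; intro j.
  exact (sub_telescope (coord x j) (coord y j) (coord z j)).
Qed.

Definition seqs_AbelianMonoid_mixin :=
  AbelianMonoid.Mixin seqs seqs_plus seqs_zero seqs_plus_comm seqs_plus_assoc seqs_plus_zero.
Canonical seqs_AbelianMonoid :=
  AbelianMonoid.Pack seqs seqs_AbelianMonoid_mixin seqs.

Definition seqs_AbelianGroup_mixin :=
  AbelianGroup.Mixin seqs_AbelianMonoid seqs_opp seqs_plus_opp.
Canonical seqs_AbelianGroup :=
  AbelianGroup.Pack seqs (AbelianGroup.Class _ _ seqs_AbelianGroup_mixin) seqs.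

Definition seqs_ModuleSpace_mixin :=
  ModuleSpace.Mixin K seqs_AbelianGroup seqs_scal
    seqs_scal_assoc seqs_scal_one seqs_scal_distr_l seqs_scal_distr_r.
Canonical seqs_ModuleSpace :=
  ModuleSpace.Pack K seqs (ModuleSpace.Class _ _ _ seqs_ModuleSpace_mixin) seqs.

Definition seqs_UniformSpace_mixin :=
  UniformSpace.Mixin seqs seqs_zero seqs_ball
    seqs_ball_center seqs_ball_sym seqs_ball_triangle.
Canonical seqs_UniformSpace :=
  UniformSpace.Pack seqs seqs_UniformSpace_mixin seqs.

Canonical seqs_NormedModuleAux :=
  NormedModuleAux.Pack K seqs
    (NormedModuleAux.Class _ _ (ModuleSpace.class _ seqs_ModuleSpace)
       seqs_UniformSpace_mixin) seqs.

Lemma seqs_norm_ball (x y : seqs) (e : R) : seqs_norm (minus y x) < e -> ball x e y.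
Proof. intro H; exact H. Qed.
Lemma seqs_ball_norm (x y : seqs) (e : posreal) :
  ball x e y -> seqs_norm (minus y x) < 1 * e.
Proof. rewrite Rmult_1_l; intro H; exact H. Qed.

Definition seqs_NormedModule_mixin :=
  NormedModule.Mixin K seqs_NormedModuleAux seqs_norm 1
    seqs_norm_triangle seqs_norm_scal seqs_norm_ball seqs_ball_norm seqs_norm_eq0.
Canonical seqs_NormedModule : NormedModule K :=
  NormedModule.Pack K seqs
    (NormedModule.Class _ _ (NormedModuleAux.class _ seqs_NormedModuleAux)
       seqs_NormedModule_mixin) seqs.

End SequenceSpaces.

Arguments seqs K E : clear implicits.
Arguments seqs_NormedModule K E : clear implicits.
Arguments coord {K E} x _.

(* Scalars are restricted to R and C: an [AbsRing] need not be commutative. *)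
Inductive scalar_field : Type := RealScalars | ComplexScalars.

Definition scalars (F : scalar_field) : AbsRing :=
  match F with RealScalars => R_AbsRing | ComplexScalars => C_AbsRing end.

Coercion scalars : scalar_field >-> AbsRing.type.

Lemma scalars_mult_comm (F : scalar_field) (a b : F) : mult a b = mult b a.
Proof. destruct F; [apply Rmult_comm|apply Cmult_comm]. Qed.

Definition bounded_weight {F : scalar_field} (w : Z -> F) : Prop :=
  exists M : R, forall j, abs (w j) <= M.

Section Shift.

Context {F : scalar_field}.
Variables (E : seqspace) (w : Z -> F) (Hw : bounded_weight w).

Definition shift_coord (x : Z -> F) (j : Z) : F := mult (w (j + 1)%Z) (x (j + 1)%Z).

Lemma shift_bound : exists M, 0 < M /\ forall x, in_space E x ->
  in_space E (shift_coord x) /\ space_norm E (shift_coord x) <= M * space_norm E x.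
Proof.
destruct Hw as [M HM]; exists (M + 1).
assert (P : 0 <= M) by (eapply Rle_trans; [apply (abs_ge_0 (w 0%Z))|apply HM]).
split; [lra|]; intros x Hx.
destruct (in_space_shift E x Hx) as [S1 S2].
destruct (in_space_bmult E (fun j => w (j + 1)%Z) _ M P (fun j => HM _) S1) as [B1 B2].
split; [exact B1|].
assert (N := space_norm_nonneg E x Hx).
eapply Rle_trans; [exact B2|]; nra.
Qed.

Lemma in_space_shift_coord (x : Z -> F) : in_space E x -> in_space E (shift_coord x).
Proof. intro H; destruct shift_bound as [M [_ HM]]; apply HM, H. Qed.

Definition shift_fun (x : seqs F E) : seqs F E :=
  exist _ (shift_coord (coord x)) (in_space_shift_coord _ (proj2_sig x)).

Lemma shift_is_linear :
  is_linear (shift_fun : seqs_NormedModule F E -> seqs_NormedModule F E).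
Proof.
split.
- intros x y; apply seqs_ext; intro j.
  exact (mult_distr_l (w (j + 1)%Z) (coord x (j + 1)%Z) (coord y (j + 1)%Z)).
- intros k x; apply seqs_ext; intro j.
  change (mult (w (j + 1)%Z) (mult k (proj1_sig x (j + 1)%Z)) =
          mult k (mult (w (j + 1)%Z) (proj1_sig x (j + 1)%Z))).
  rewrite !mult_assoc, (scalars_mult_comm _ k); reflexivity.
- destruct shift_bound as [M [HM B]]; exists M; split; [exact HM|].
  intro x; exact (proj2 (B _ (proj2_sig x))).
Qed.

Definition backward_shift : operator (seqs_NormedModule F E) :=
  Operator shift_fun shift_is_linear.

End Shift.

(* Main.v *)
Require Import Defs.
From Stdlib Require Import ZArith List Lra Lia FunctionalExtensionality Classical ClassicalEpsilon.

(** Write the weights as [w_j = exp (psi (j - 1) - psi j)] for a potential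
    [psi] on the integers with [psi 0 = 0].  The products telescope, so that
    [B_w^n e_k = exp (psi (k - n) - psi k) e_{k-n}], and likewise
    [B_w^{-n} e_k = exp (psi (k + n) - psi k) e_{k+n}].  If [psi] is 1-Lipschitz
    the weights lie between [exp (-1)] and [exp 1].  If [psi] is moreover even,
    the reflection [x_j -> x_{-j}] conjugates [B_w] to its inverse, so every
    norm estimate for [B_w] holds for the inverse as well.

    What remains is to choose [psi] so that [psi n] is above any [M] on
    arbitrarily late windows [m <= n <= m^2], and below any [M] on other such
    windows.  A set containing arbitrarily late windows has upper density 1,
    because [m^2 - m] of the first [m^2] integers belong to it.  Such a
    potential is [psi j = zigzag (log2 (log2 |j|))], where [zigzag] is an
    integer sequence with steps at most 1 and peaks of unbounded height of both
    signs: as [n] runs through a window starting at [m = 2^(2^i)],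
    the double logarithm only takes the values [i] and [i + 1].

    - If [x_k] is not 0, then [norm (B_w^n x)] is at least a constant times
      [exp (psi n)], by the Lipschitz property.  On a high window this makes the
      averages of the norms over [0..m^2] arbitrarily large: average positive
      expansivity ([average_positively_expansive_windows]).
    - For the same reason [B_w^n e_0] is large on a set of times of upper
      density 1, and small on another one; then the real line spanned by [e_0]
      is a distributionally scrambled set ([distributionally_chaotic_windows]).
    - At a time [n] where [psi n] is very negative, both [B_w^n u] and
      [B_w^{-n} v] are small for given finitely supported [u] and [v].  Then
      [u + B_w^{-n} v] is close to [u] and its image under [B_w^n] is close to
      [v]; density of such vectors gives transitivity
      ([shift_topologically_transitive]). *)

(** * Sets of times containing long windows *)

(** The square is what matters: a window up to [m^2] contains almost all the
    integers below its right end. *)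

Definition holds_on_windows (A : nat -> Prop) : Prop :=
  forall m0 : nat, exists m : nat, (m0 <= m)%nat /\
    forall n : nat, (m <= n <= m * m)%nat -> A n.

Lemma holds_on_windows_impl (A B : nat -> Prop) :
  (forall n, A n -> B n) -> holds_on_windows A -> holds_on_windows B.
Proof.
intros H W m0; destruct (W m0) as [m [Hm HA]].
exists m; split; [exact Hm|]; intros n Hn; apply H, HA, Hn.
Qed.

Lemma holds_on_windows_ex (A : nat -> Prop) : holds_on_windows A -> exists n, A n.
Proof.
intro W; destruct (W 1%nat) as [m [Hm HA]]; exists m; apply HA; nia.
Qed.

Lemma count_le (A : nat -> Prop) (n : nat) : (count A n <= n)%nat.
Proof.
unfold count; eapply Nat.le_trans; [apply filter_length_le|].
rewrite length_seq; apply Nat.le_refl.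
Qed.

Lemma count_window (A : nat -> Prop) (m n : nat) :
  (m <= n)%nat -> (forall k, (m < k <= n)%nat -> A k) -> (n - m <= count A n)%nat.
Proof.
intros Hmn HA; unfold count.
replace n with (m + (n - m))%nat at 2 by lia.
rewrite seq_app, filter_app, length_app.
rewrite (forallb_filter_id _ (seq (1 + m) (n - m))).
- rewrite length_seq; lia.
- apply forallb_forall; intros k Hk; apply in_seq in Hk.
  destruct excluded_middle_informative as [h|h]; [reflexivity|].
  exfalso; apply h, HA; lia.
Qed.

(** For [n = m^2] the proportion of times in the set is at least [1 - 1/m]. *)
Lemma upper_density_windows (A : nat -> Prop) :
  holds_on_windows A -> upper_density A = Finite 1.
Proof.
intro W; apply is_LimSup_seq_unique; intro eps; split.
- intro N.
  destruct (INR_unbounded (/ eps)) as [k Hk].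
  destruct (W (S (N + k))) as [m [Hm HA]].
  exists (m * m)%nat; split; [nia|].
  assert (Hc : (m * m - m <= count A (m * m))%nat).
  { apply count_window; [nia|]; intros j Hj; apply HA; lia. }
  apply le_INR in Hc; rewrite minus_INR, mult_INR in Hc by nia.
  assert (He := cond_pos eps).
  assert (Hkm : INR k < INR m) by (apply lt_INR; lia).
  assert (Hi := Rinv_0_lt_compat _ He).
  assert (Hem : 1 < eps * INR m).
  { apply (Rmult_lt_reg_l (/ eps)); [exact Hi|].
    rewrite <- Rmult_assoc, Rinv_l by lra; lra. }
  rewrite mult_INR.
  apply (Rmult_lt_reg_r (INR m * INR m)); [nra|].
  unfold Rdiv; rewrite Rmult_assoc, Rinv_l by nra; nra.
- exists 1%nat; intros n Hn.
  assert (He := cond_pos eps).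
  assert (Hn' : 0 < INR n) by (apply lt_0_INR; lia).
  assert (Hc := le_INR _ _ (count_le A n)).
  apply Rle_lt_trans with 1; [|lra].
  apply (Rmult_le_reg_r (INR n)); [exact Hn'|].
  unfold Rdiv; rewrite Rmult_assoc, Rinv_l by lra; lra.
Qed.

Lemma sum_n_window (f : nat -> R) (c : R) (m n : nat) :
  0 <= c -> (forall k, 0 <= f k) -> (forall k, (m <= k <= n)%nat -> c <= f k) ->
  c * (INR n + 1 - INR m) <= sum_n f n.
Proof.
intros Hc H0; induction n as [|n IH]; intro H.
- rewrite sum_O; destruct m as [|m].
  + specialize (H 0%nat ltac:(lia)); simpl; lra.
  + rewrite S_INR; assert (Hm := pos_INR m); specialize (H0 0%nat); simpl; nra.
- rewrite sum_Sn; change plus with Rplus; rewrite S_INR.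
  assert (IH' := IH (fun k Hk => H k ltac:(lia))).
  destruct (le_lt_dec m (S n)) as [Hm|Hm].
  + specialize (H (S n) ltac:(lia)); lra.
  + assert (INR (S n) + 1 <= INR m) by (rewrite <- S_INR; apply le_INR; lia).
    rewrite S_INR in H1.
    assert (0 <= sum_n f n).
    { clear - H0; induction n; [rewrite sum_O|rewrite sum_Sn; change plus with Rplus];
        [apply H0|specialize (H0 (S n)); lra]. }
    specialize (H0 (S n)); nra.
Qed.

(** * Uncountability of the reals *)

(** Cantor's nested intervals: the [n]-th step discards [u n], so a common point
    of all the intervals is no [u n]; but [u], a left inverse of [f], takes
    every real value. *)
Lemma no_injection_R_nat (f : R -> nat) : ~ (forall s t, f s = f t -> s = t).
Proof.
intro Hf.
set (u := fun n => epsilon (inhabits 0) (fun x => f x = n)).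
(* [f] being injective, [x] is the only choice that [epsilon] has. *)
assert (Hu : forall x, u (f x) = x).
{ intro x; apply Hf; apply (epsilon_spec (inhabits 0) (fun y => f y = f x)); exists x; reflexivity. }
set (step := fun n (I : R * R) =>
  let (a, b) := I in
  if Rlt_dec (u n) ((a + b) / 2) then ((a + b) / 2, b) else (a, a + (b - a) / 4)).
set (I := nat_rect (fun _ => (R * R)%type) (0, 1) step).
assert (HI : forall n, fst (I n) < snd (I n)).
{ induction n as [|n IH]; [simpl; lra|].
  change (I (S n)) with (step n (I n)); destruct (I n) as [a b]; simpl in *.
  destruct Rlt_dec; simpl; lra. }
assert (Hs : forall n, fst (I n) <= fst (I (S n)) /\ snd (I (S n)) <= snd (I n) /\
  (u n < fst (I (S n)) \/ snd (I (S n)) < u n)).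
{ intro n; specialize (HI n).
  change (I (S n)) with (step n (I n)); destruct (I n) as [a b]; simpl in *.
  destruct Rlt_dec; simpl; lra. }
assert (Hn : forall k n, fst (I n) <= fst (I (k + n)%nat) /\ snd (I (k + n)%nat) <= snd (I n)).
{ induction k as [|k IH]; intro n; [simpl; lra|].
  specialize (IH n); specialize (Hs (k + n)%nat); rewrite Nat.add_succ_l; lra. }
assert (Hab : forall m n, fst (I m) <= snd (I n)).
{ intros m n; assert (A := Hn n m); assert (B := Hn m n).
  rewrite Nat.add_comm in B; specialize (HI (n + m)%nat); lra. }
destruct (completeness (fun x => exists n, x = fst (I n))) as [l [Hl1 Hl2]].
- exists (snd (I 0%nat)); intros x [n ->]; apply Hab.
- exists (fst (I 0%nat)), 0%nat; reflexivity.
- destruct (Hs (f l)) as [_ [_ H]]; rewrite Hu in H.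
  assert (fst (I (S (f l))) <= l) by (apply Hl1; eexists; reflexivity).
  assert (l <= snd (I (S (f l)))) by (apply Hl2; intros x [n ->]; apply Hab).
  lra.
Qed.

(** * Real numbers as scalars *)

Definition of_real (F : scalar_field) : R -> F :=
  match F with RealScalars => fun r => r | ComplexScalars => RtoC end.

Lemma abs_of_real (F : scalar_field) (r : R) : abs (of_real F r) = Rabs r.
Proof. destruct F; [reflexivity|apply Cmod_R]. Qed.

Lemma of_real_mult (F : scalar_field) (r s : R) :
  mult (of_real F r) (of_real F s) = of_real F (r * s).
Proof. destruct F; [reflexivity|symmetry; apply RtoC_mult]. Qed.

Lemma of_real_minus (F : scalar_field) (r s : R) :
  minus (of_real F r) (of_real F s) = of_real F (r - s).
Proof. destruct F; [reflexivity|symmetry; apply RtoC_minus]. Qed.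

Lemma of_real_1 (F : scalar_field) : of_real F 1 = one.
Proof. destruct F; reflexivity. Qed.

Lemma scal_minus_distr_r {K : Ring} {V : ModuleSpace K} (k l : K) (x : V) :
  scal (minus k l) x = minus (scal k x) (scal l x).
Proof.
etransitivity; [exact (scal_distr_r k (opp l) x)|].
rewrite scal_opp_l; reflexivity.
Qed.

(** The axioms of a normed module only give the inequality from left to right;
    applying it to the inverse scalar gives the other one. *)
Lemma norm_scal_of_real (F : scalar_field) (X : NormedModule F) (r : R) (x : X) :
  norm (scal (of_real F r) x) = Rabs r * norm x.
Proof.
assert (L : forall s (y : X), norm (scal (of_real F s) y) <= Rabs s * norm y).
{ intros s y; rewrite <- (abs_of_real F); apply (norm_scal (of_real F s) y). }
apply Rle_antisym; [apply L|].
destruct (Req_dec r 0) as [->|Hr].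
- rewrite Rabs_R0, Rmult_0_l; apply norm_ge_0.
- assert (H := L (/ r) (scal (of_real F r) x)).
  rewrite scal_assoc, of_real_mult, Rinv_l, of_real_1, scal_one, Rabs_inv in H by exact Hr.
  assert (P := Rabs_pos_lt r Hr).
  apply (Rmult_le_compat_l (Rabs r)) in H; [|lra].
  rewrite <- Rmult_assoc, Rinv_r, Rmult_1_l in H by lra; exact H.
Qed.

(** * Criteria for expansivity and chaos *)

Lemma orbit_plus {K : AbsRing} {X : NormedModule K} (T : operator X) (x y : X) n :
  orbit T (plus x y) n = plus (orbit T x n) (orbit T y n).
Proof.
induction n as [|n IH]; [reflexivity|].
unfold orbit in *; simpl; rewrite IH; apply (linear_plus _ (op_is_linear _ T)).
Qed.

Lemma orbit_scal {K : AbsRing} {X : NormedModule K} (T : operator X) (k : K) (x : X) n :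
  orbit T (scal k x) n = scal k (orbit T x n).
Proof.
induction n as [|n IH]; [reflexivity|].
unfold orbit in *; simpl; rewrite IH; apply (linear_scal _ (op_is_linear _ T)).
Qed.

Lemma orbit_inverse {K : AbsRing} {X : NormedModule K} (T S : operator X) :
  is_inverse T S -> forall (x : X) n, orbit T (orbit S x n) n = x.
Proof.
intros [_ H] x n; induction n as [|n IH]; [reflexivity|].
unfold orbit in *; rewrite Nat.iter_succ_r; simpl; rewrite H; exact IH.
Qed.

Lemma norm_minus_plus_lt {K : AbsRing} {X : NormedModule K} (x y a : X) (r s t : R) :
  norm (minus x a) < r -> norm y < s -> r + s <= t -> norm (minus (plus x y) a) < t.
Proof.
intros Hx Hy Ht; replace (minus (plus x y) a) with (plus (minus x a) y).
- eapply Rle_lt_trans; [apply norm_triangle|lra].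
- unfold minus; rewrite <- !plus_assoc; f_equal; apply plus_comm.
Qed.

(** If the norms are at least [2 C] on a window from [m] to [m^2], which fills at
    least half of the first [m^2 + 1] times, then the average over these times is
    at least [C]. *)
Lemma average_positively_expansive_windows
  {K : AbsRing} {X : NormedModule K} (T : operator X) :
  (forall (x : X) (M : R), x <> zero ->
     holds_on_windows (fun n => M <= norm (orbit T x n))) ->
  average_positively_expansive T.
Proof.
intros H x Hx.
destruct (Lub_Rbar_correct (fun r => exists n, (1 <= n)%nat /\ r = orbit_average T x n)) as [U _].
assert (V : forall C : R, 0 <= C -> exists n, (1 <= n)%nat /\ C <= orbit_average T x n).
{ intros C HC; destruct (H x (2 * C) Hx 0%nat) as [m [_ Hm]].
  exists (S (m * m)); split; [lia|]; unfold orbit_average.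
  assert (B := sum_n_window (fun j => norm (orbit T x j)) (2 * C) m (m * m)
    ltac:(lra) (fun k => norm_ge_0 _) Hm).
  replace (S (m * m) - 1)%nat with (m * m)%nat by lia.
  assert (P := pos_INR m); rewrite mult_INR in B; rewrite S_INR, mult_INR.
  apply (Rmult_le_reg_r (INR m * INR m + 1)); [nra|].
  unfold Rdiv; rewrite Rmult_assoc, Rinv_l by nra.
  (* [2 (m^2 + 1 - m) - (m^2 + 1) = (m - 1)^2] *)
  assert (0 <= (INR m - 1) * (INR m - 1)) by apply Rle_0_sqr.
  nra. }
destruct (Lub_Rbar _) as [l| |].
- exfalso; destruct (V (Rabs l + 1)) as [n [Hn HC]]; [assert (A := Rabs_pos l); lra|].
  assert (A := U _ (ex_intro _ n (conj Hn eq_refl))); simpl in A.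
  assert (B := Rle_abs l); lra.
- reflexivity.
- exfalso; destruct (V 0) as [n [Hn HC]]; [lra|].
  exact (U _ (ex_intro _ n (conj Hn eq_refl))).
Qed.

(** The scrambled set is the real line through [x]: two of its points differ by
    a nonzero multiple of [x], whose orbit is as irregular as that of [x].  A
    single threshold, here 1, serves all pairs because the orbit of [x] exceeds
    every bound. *)
Lemma distributionally_chaotic_windows
  {F : scalar_field} {X : NormedModule F} (T : operator X) (x : X) :
  (forall M, holds_on_windows (fun n => M <= norm (orbit T x n))) ->
  (forall tau, 0 < tau -> holds_on_windows (fun n => norm (orbit T x n) < tau)) ->
  distributionally_chaotic T.
Proof.
intros Hlarge Hsmall.
assert (D : forall s t n,
  norm (minus (orbit T (scal (of_real F s) x) n) (orbit T (scal (of_real F t) x) n))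
    = Rabs (s - t) * norm (orbit T x n)).
{ intros s t n; rewrite !orbit_scal, <- norm_scal_of_real, <- of_real_minus.
  f_equal; symmetry; apply (scal_minus_distr_r (V := X)). }
exists (fun y => exists t, y = scal (of_real F t) x), 1; split; [|split; [lra|]].
- intros [f Hf].
  apply (no_injection_R_nat (fun t => f (scal (of_real F t) x))).
  intros s t E; apply Hf in E; try (eexists; reflexivity).
  destruct (holds_on_windows_ex _ (Hlarge 1)) as [n Hn].
  specialize (D s t n); rewrite E, minus_eq_zero in D.
  assert (Z : norm (zero : X) = 0) by apply norm_zero.
  change (norm (zero : X) = Rabs (s - t) * norm (orbit T x n)) in D; rewrite Z in D.
  destruct (Req_dec (s - t) 0) as [e|e]; [lra|].
  apply Rabs_pos_lt in e; nra.
- intros y z [s ->] [t ->] Hst.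
  assert (P : 0 < Rabs (s - t)).
  { apply Rabs_pos_lt; intro e; apply Hst; f_equal; f_equal; lra. }
  assert (Q := Rinv_0_lt_compat _ P).
  split.
  + apply upper_density_windows.
    apply (holds_on_windows_impl _ _) with (2 := Hlarge (/ Rabs (s - t))).
    intros n Hn; rewrite D.
    apply (Rmult_le_compat_l (Rabs (s - t))) in Hn; [|lra].
    rewrite Rinv_r in Hn by lra; lra.
  + intros tau Ht; apply upper_density_windows.
    apply (holds_on_windows_impl _ _) with
      (2 := Hsmall (tau * / Rabs (s - t)) (Rmult_lt_0_compat _ _ Ht Q)).
    intros n Hn; rewrite D.
    apply (Rmult_lt_compat_l (Rabs (s - t))) in Hn; [|lra].
    replace (Rabs (s - t) * (tau * / Rabs (s - t))) with tau in Hn by (field; lra).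
    exact Hn.
Qed.

(** * Transfer along an isometric conjugacy *)

Section Conjugacy.

Context {K : AbsRing} {X : NormedModule K}.
Variables (J : X -> X) (T S : operator X).
Hypothesis J_linear : is_linear J.
Hypothesis J_involutive : forall x, J (J x) = x.
Hypothesis J_isometric : forall x, norm (J x) = norm x.
Hypothesis J_conj : forall x, J (S x) = T (J x).

Lemma conjugate_orbit x n : J (orbit S x n) = orbit T (J x) n.
Proof.
induction n as [|n IH]; [reflexivity|].
unfold orbit in *; simpl; rewrite J_conj, IH; reflexivity.
Qed.

Lemma average_positively_expansive_conjugate :
  average_positively_expansive T -> average_positively_expansive S.
Proof.
intros H x Hx.
replace (orbit_average S x) with (orbit_average T (J x)).
- apply H; intro e; apply Hx; rewrite <- (J_involutive x), e.
  apply linear_zero, J_linear.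
- extensionality n; unfold orbit_average; do 2 f_equal.
  extensionality j; rewrite <- conjugate_orbit; apply J_isometric.
Qed.

Lemma distributionally_chaotic_conjugate :
  distributionally_chaotic T -> distributionally_chaotic S.
Proof.
intros [G [eps [HG [He H]]]].
exists (fun x => G (J x)), eps; split; [|split; [exact He|]].
- intros [f Hf]; apply HG; exists (fun x => f (J x)); intros x y Hx Hy E.
  rewrite <- (J_involutive x), <- (J_involutive y).
  f_equal; apply Hf; rewrite ?J_involutive; auto.
- intros x y Hx Hy Hxy.
  assert (N : forall n, norm (minus (orbit S x n) (orbit S y n)) =
                        norm (minus (orbit T (J x) n) (orbit T (J y) n))).
  { intro n; rewrite <- !conjugate_orbit, <- J_isometric; f_equal.
    unfold minus; rewrite (linear_plus _ J_linear), (linear_opp _ _ J_linear); reflexivity. }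
  destruct (H (J x) (J y) Hx Hy) as [H1 H2].
  { intro e; apply Hxy; rewrite <- (J_involutive x), e; apply J_involutive. }
  split; [rewrite <- H1|intros tau Ht; rewrite <- (H2 tau Ht)];
    f_equal; extensionality n; rewrite N; reflexivity.
Qed.

End Conjugacy.

(** * Series and truncations *)

Lemma ex_series_eventually_zero (a : nat -> R) (N : nat) :
  (forall n, (N <= n)%nat -> a n = 0) -> ex_series a.
Proof.
intro H; apply (ex_series_incr_n a N).
exists 0; apply filterlim_ext with (fun _ : nat => 0); [|apply filterlim_const].
intro n; induction n as [|n IH].
- rewrite sum_O; symmetry; apply H; lia.
- rewrite sum_Sn, <- IH, H by lia; symmetry; apply (plus_zero_r (G := R_AbelianGroup)).
Qed.

Lemma Series_tail_small (a : nat -> R) (eps : R) :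
  ex_series a -> 0 < eps ->
  exists N0, forall N, (N0 <= N)%nat ->
    Series (fun n => if lt_dec n N then 0 else a n) < eps.
Proof.
intros Ha He.
assert (L : is_lim_seq (sum_n a) (Series a)) by exact (Series_correct a Ha).
destruct (proj1 (is_lim_seq_Reals _ _) L eps He) as [N0 HN].
exists (S N0); intros N HN0.
rewrite (Series_incr_n_aux _ N).
- rewrite (Series_ext _ (fun k => a (N + k)%nat)).
  + assert (E := Series_incr_n a N ltac:(lia) Ha).
    specialize (HN (pred N) ltac:(lia)); rewrite sum_n_Reals in HN.
    unfold Rdist in HN; apply Rabs_def2 in HN; lra.
  + intro k; destruct lt_dec; [lia|reflexivity].
- intros k Hk; destruct lt_dec; [reflexivity|lia].
Qed.

Lemma zseries_tail_small (a : Z -> R) (eps : R) :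
  ex_zseries a -> 0 < eps ->
  exists N, zseries (fun j => if Z_lt_dec (Z.abs j) N then 0 else a j) < eps.
Proof.
intros [H1 H2] He.
destruct (Series_tail_small _ (eps / 2) H1 ltac:(lra)) as [N1 T1].
destruct (Series_tail_small _ (eps / 2) H2 ltac:(lra)) as [N2 T2].
set (N := (N1 + N2)%nat).
exists (Z.of_nat (S N)); unfold zseries.
specialize (T1 (S N) ltac:(lia)); specialize (T2 N ltac:(lia)).
rewrite (Series_ext (zpos _) (fun n => if lt_dec n (S N) then 0 else zpos a n)).
- rewrite (Series_ext (zneg _) (fun n => if lt_dec n N then 0 else zneg a n)); [lra|].
  intro n; unfold zneg; destruct Z_lt_dec, lt_dec; try reflexivity; lia.
- intro n; unfold zpos; destruct Z_lt_dec, lt_dec; try reflexivity; lia.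
Qed.

Lemma zseries_reflect (a : Z -> R) :
  ex_zseries a ->
  ex_zseries (fun j => a (- j)%Z) /\ zseries (fun j => a (- j)%Z) = zseries a.
Proof.
intros [H1 H2]; set (b := fun j => a (- j)%Z).
assert (E1 : zneg a = fun n => zpos b (S n)) by reflexivity.
assert (E2 : zneg b = fun n => zpos a (S n)).
{ extensionality n; unfold zneg, zpos, b; f_equal; lia. }
assert (P : ex_series (zpos b)).
{ apply (proj2 (ex_series_incr_1 (zpos b))); rewrite <- E1; exact H2. }
split; [split; [exact P|]|].
- rewrite E2; exact (proj1 (ex_series_incr_1 (zpos a)) H1).
- unfold zseries; rewrite E1, E2, (Series_incr_1 _ P), (Series_incr_1 _ H1).
  change (zpos b 0) with (zpos a 0); ring.
Qed.

(** * Vectors of the sequence spaces *)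

Section SpaceFacts.

Context {K : AbsRing} {E : seqspace}.

Lemma in_space_reflect (x : Z -> K) : in_space E x ->
  in_space E (fun j => x (- j)%Z) /\
  space_norm E (fun j => x (- j)%Z) <= space_norm E x.
Proof.
destruct E as [|p Hp]; intro Hx.
- split.
  + intros eps He; destruct (Hx eps He) as [N HN].
    exists N; intros j Hj; apply HN; lia.
  + apply c0_norm_lub; intro j; apply (c0_norm_ub x (- j)%Z Hx).
- destruct (zseries_reflect (fun j => rpow (abs (x j)) p) Hx) as [S1 S2].
  split; [exact S1|]; simpl; rewrite S2; lra.
Qed.

Lemma in_space_shift_iter (x : Z -> K) (n : nat) : in_space E x ->
  in_space E (fun j => x (j + Z.of_nat n)%Z) /\
  space_norm E (fun j => x (j + Z.of_nat n)%Z) <= space_norm E x.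
Proof.
intro Hx; induction n as [|n [I1 I2]].
- replace (fun j => x (j + Z.of_nat 0)%Z) with x; [split; [exact Hx|lra]|].
  extensionality j; f_equal; lia.
- replace (fun j => x (j + Z.of_nat (S n))%Z) with (fun j => x (j + 1 + Z.of_nat n)%Z)
    by (extensionality j; f_equal; lia).
  destruct (in_space_shift E _ I1) as [S1 S2].
  split; [exact S1|]; eapply Rle_trans; [exact S2|exact I2].
Qed.

Lemma coord_le_norm (x : seqs_NormedModule K E) (j : Z) : abs (coord x j) <= norm x.
Proof.
destruct x as [x Hx]; change (abs (x j) <= space_norm E x).
destruct E as [|p Hp]; [apply c0_norm_ub, Hx|].
assert (B := zseries_term_le (fun j => rpow (abs (x j)) p) j (fun i => rpow_nonneg _ _) Hx).
simpl in *; rewrite <- (rpow_1 (abs (x j))), <- (Rinv_r p), <- rpow_rpow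
  by (lra || apply abs_ge_0).
apply rpow_le; [left; apply Rinv_0_lt_compat; lra|split; [apply rpow_nonneg|exact B]].
Qed.

Lemma in_space_supported (x : Z -> K) (N : Z) :
  (forall j, (N < Z.abs j)%Z -> x j = zero) -> in_space E x.
Proof.
intro H; destruct E as [|p Hp].
- intros eps He; exists (N + 1)%Z; intros j Hj; rewrite H, abs_zero by lia; exact He.
- split; apply (ex_series_eventually_zero _ (S (Z.to_nat N))); intros n Hn;
    unfold zpos, zneg; rewrite H, abs_zero by lia; apply rpow_0.
Qed.

Definition supported (N : Z) (u : seqs K E) : Prop :=
  forall j, (N < Z.abs j)%Z -> coord u j = zero.

Lemma supported_dense (x : seqs_NormedModule K E) (eps : R) : 0 < eps ->
  exists (N : Z) (u : seqs_NormedModule K E),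
    supported N u /\ norm (minus u x) < eps.
Proof.
intro He.
set (tr := fun (N : Z) j => if Z_lt_dec (Z.abs j) N then coord x j else zero).
assert (Htr : forall N j, (N <= Z.abs j)%Z -> tr N j = zero).
{ intros N j Hj; unfold tr; destruct Z_lt_dec; [lia|reflexivity]. }
assert (Hin : forall N, in_space E (tr N)).
{ intro N; apply (in_space_supported _ N); intros j Hj; apply Htr; lia. }
assert (D : forall N j, abs (plus (tr N j) (opp (coord x j))) =
                        if Z_lt_dec (Z.abs j) N then 0 else abs (coord x j)).
{ intros N j; unfold tr; destruct Z_lt_dec.
  - etransitivity; [apply f_equal; exact (plus_opp_r (coord x j))|apply abs_zero].
  - etransitivity; [apply f_equal; exact (plus_zero_l (opp (coord x j)))|apply abs_opp]. }
assert (Hex : exists N, space_norm E (fun j => plus (tr N j) (opp (coord x j))) <= eps / 2).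
{ assert (Hd : forall N, in_space E (fun j => plus (tr N j) (opp (coord x j)))).
  { intro N; apply in_space_plus; [apply Hin|apply in_space_opp, (proj2_sig x)]. }
  clear Hin; destruct x as [x Hx]; simpl in *; destruct E as [|p Hp].
  - destruct (Hx (eps / 2) ltac:(lra)) as [N HN]; exists N.
    apply c0_norm_lub; intro j; rewrite D; destruct Z_lt_dec; [lra|].
    left; apply HN; lia.
  - destruct (zseries_tail_small _ (rpow (eps / 2) p) Hx) as [N HN].
    { apply rpow_gt0; lra. }
    exists N; apply lp_norm_le; [lra|apply Hd|].
    left; eapply Rle_lt_trans; [|exact HN]; right; f_equal.
    extensionality j; rewrite D; destruct Z_lt_dec; [apply rpow_0|reflexivity]. }
destruct Hex as [N HN].
exists N, (exist _ (tr N) (Hin N)); split.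
- intros j Hj; apply Htr; lia.
- eapply Rle_lt_trans; [exact HN|lra].
Qed.

Lemma supported_ex : exists e : seqs K E, supported 0 e /\ coord e 0%Z = one.
Proof.
set (e := fun j => if Z.eq_dec j 0 then one else zero : K).
assert (He : forall j, (0 < Z.abs j)%Z -> e j = zero).
{ intros j Hj; unfold e; destruct Z.eq_dec; [lia|reflexivity]. }
exists (exist _ e (in_space_supported e 0 He)); split; [exact He|reflexivity].
Qed.

Definition reflect (x : seqs K E) : seqs K E :=
  exist _ (fun j => coord x (- j)%Z) (proj1 (in_space_reflect _ (proj2_sig x))).

Lemma reflect_involutive x : reflect (reflect x) = x.
Proof. apply seqs_ext; intro j; unfold reflect; simpl; f_equal; lia. Qed.

Lemma norm_reflect (x : seqs_NormedModule K E) :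
  norm (reflect x : seqs_NormedModule K E) = norm x.
Proof.
assert (L : forall y : seqs_NormedModule K E,
          norm (reflect y : seqs_NormedModule K E) <= norm y).
{ intro y; exact (proj2 (in_space_reflect _ (proj2_sig y))). }
apply Rle_antisym; [apply L|].
rewrite <- (reflect_involutive x) at 1; apply L.
Qed.

Lemma reflect_is_linear :
  is_linear (reflect : seqs_NormedModule K E -> seqs_NormedModule K E).
Proof.
split.
- intros x y; apply seqs_ext; intro j; reflexivity.
- intros k x; apply seqs_ext; intro j; reflexivity.
- exists 1; split; [lra|]; intro x; rewrite norm_reflect; lra.
Qed.

End SpaceFacts.

(** * Oscillating potentials and their weights *)

Record oscillating (psi : Z -> R) : Prop := Oscillating {
  osc_zero : psi 0%Z = 0;
  osc_even : forall j, psi (- j)%Z = psi j;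
  osc_step : forall j, Rabs (psi (j + 1)%Z - psi j) <= 1;
  osc_high : forall M, holds_on_windows (fun n => M <= psi (Z.of_nat n));
  osc_low : forall M, holds_on_windows (fun n => psi (Z.of_nat n) <= M)
}.

Lemma oscillating_lipschitz (psi : Z -> R) : oscillating psi ->
  forall j k, Rabs (psi (j + k)%Z - psi j) <= IZR (Z.abs k).
Proof.
intros H.
assert (P : forall (n : nat) j, Rabs (psi (j + Z.of_nat n)%Z - psi j) <= INR n).
{ induction n as [|n IH]; intro j.
  - rewrite Z.add_0_r, Rminus_diag, Rabs_R0; simpl; lra.
  - specialize (IH j); assert (A := osc_step _ H (j + Z.of_nat n)%Z).
    replace (j + Z.of_nat (S n))%Z with (j + Z.of_nat n + 1)%Z by lia.
    rewrite S_INR; apply Rabs_le_between in IH; apply Rabs_le_between in A.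
    apply Rabs_le; lra. }
intros j k; destruct (Z_le_dec 0 k) as [Hk|Hk].
- specialize (P (Z.to_nat k) j); rewrite INR_IZR_INZ, Z2Nat.id in P by lia.
  rewrite Z.abs_eq by lia; exact P.
- specialize (P (Z.to_nat (- k)) (j + k)%Z); rewrite INR_IZR_INZ, Z2Nat.id in P by lia.
  replace (j + k + - k)%Z with j in P by lia.
  rewrite Rabs_minus_sym, Z.abs_neq by lia; exact P.
Qed.

(** The left-hand quantity is the logarithm of the norm of [B_w^n e_k] divided by
    that of [B_w^n e_0]: starting at another coordinate changes the growth along
    the orbit by a factor bounded independently of [n].  Evenness lets [psi n]
    replace [psi (- n)]. *)
Lemma oscillating_drift (psi : Z -> R) : oscillating psi -> forall k n,
  Rabs (psi (k - n)%Z - psi k - psi n) <= 2 * IZR (Z.abs k).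
Proof.
intros H k n.
assert (A := oscillating_lipschitz _ H (- n) k).
assert (B := oscillating_lipschitz _ H 0 k).
rewrite (osc_zero _ H), Z.add_0_l in B; rewrite (osc_even _ H) in A.
replace (- n + k)%Z with (k - n)%Z in A by lia.
apply Rabs_le_between in A; apply Rabs_le_between in B; apply Rabs_le; lra.
Qed.

Lemma exp_le_monotone a b : a <= b -> exp a <= exp b.
Proof. intros [H|<-]; [left; apply exp_increasing, H|apply Rle_refl]. Qed.

(** With these weights the product of [n] consecutive weights telescopes, so
    every entry of an iterate of the shift is explicit. *)
Definition potential_weight (F : scalar_field) (psi : Z -> R) (j : Z) : F :=
  of_real F (exp (psi (j - 1)%Z - psi j)).

(** * The weighted shift of an oscillating potential *)

Section PotentialShift.

Context {F : scalar_field} {E : seqspace} {psi : Z -> R}.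
Hypothesis psi_osc : oscillating psi.

Lemma abs_potential_weight j :
  exp (- 1) <= abs (potential_weight F psi j) <= exp 1.
Proof.
unfold potential_weight; rewrite abs_of_real, Rabs_pos_eq by (left; apply exp_pos).
assert (A := osc_step _ psi_osc (j - 1)%Z).
replace (j - 1 + 1)%Z with j in A by lia; apply Rabs_le_between in A.
split; apply exp_le_monotone; lra.
Qed.

Lemma potential_weight_bounded : bounded_weight (potential_weight F psi).
Proof. exists (exp 1); intro j; apply abs_potential_weight. Qed.

Lemma potential_weight_bounded_below :
  Rbar_lt 0 (Glb_Rbar (fun r => exists j : Z, r = abs (potential_weight F psi j))).
Proof.
destruct (Glb_Rbar_correct (fun r => exists j : Z, r = abs (potential_weight F psi j)))
  as [_ L].
specialize (L (exp (- 1))); eapply Rbar_lt_le_trans; [|apply L].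
- apply exp_pos.
- intros r [j ->]; apply abs_potential_weight.
Qed.

Let T : operator (seqs_NormedModule F E) :=
  backward_shift E (potential_weight F psi) potential_weight_bounded.

Lemma coord_orbit_shift (x : seqs_NormedModule F E) n j :
  coord (orbit T x n) j =
  mult (of_real F (exp (psi j - psi (j + Z.of_nat n)%Z))) (coord x (j + Z.of_nat n)%Z).
Proof.
revert j; induction n as [|n IH]; intro j.
- rewrite Z.add_0_r, Rminus_diag, exp_0, of_real_1; symmetry; apply (mult_one_l (K := F)).
- change (coord (orbit T x (S n)) j) with
    (mult (potential_weight F psi (j + 1)%Z) (coord (orbit T x n) (j + 1)%Z)).
  rewrite IH, mult_assoc; unfold potential_weight; rewrite of_real_mult, <- exp_plus.
  replace (j + 1 + Z.of_nat n)%Z with (j + Z.of_nat (S n))%Z by lia.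
  replace (j + 1 - 1)%Z with j by lia.
  f_equal; do 2 f_equal; ring.
Qed.

Lemma norm_orbit_shift_ge (x : seqs_NormedModule F E) k n :
  exp (psi (Z.of_nat n) - 2 * IZR (Z.abs k)) * abs (coord x k) <= norm (orbit T x n).
Proof.
eapply Rle_trans; [|apply (coord_le_norm _ (k - Z.of_nat n)%Z)].
rewrite coord_orbit_shift; replace (k - Z.of_nat n + Z.of_nat n)%Z with k by lia.
set (c := psi (k - Z.of_nat n)%Z - psi k).
replace (abs (mult _ _)) with (exp c * abs (coord x k)).
- apply Rmult_le_compat_r; [apply abs_ge_0|]; apply exp_le_monotone; unfold c.
  assert (A := oscillating_drift _ psi_osc k (Z.of_nat n)).
  apply Rabs_le_between in A; lra.
- transitivity (norm (scal (of_real F (exp c)) (coord x k : AbsRing_NormedModule F))).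
  + rewrite norm_scal_of_real, Rabs_pos_eq by (left; apply exp_pos); reflexivity.
  + reflexivity.
Qed.

(** On vectors supported in a fixed interval, the [n]-th iterate is a bounded
    multiplier followed by [n] unweighted shifts, which do not increase norms. *)
Lemma norm_orbit_shift_le (u : seqs_NormedModule F E) N n :
  supported N u ->
  norm (orbit T u n) <= exp (psi (Z.of_nat n) + 2 * IZR N) * norm u.
Proof.
intro Hu; set (M := exp (psi (Z.of_nat n) + 2 * IZR N)).
set (m := fun k => if Z_le_dec (Z.abs k) N
                   then of_real F (exp (psi (k - Z.of_nat n)%Z - psi k)) else zero).
assert (HM : 0 <= M) by (left; apply exp_pos).
assert (Hm : forall k, abs (m k) <= M).
{ intro k; unfold m; destruct Z_le_dec as [Hk|Hk]; [|rewrite abs_zero; exact HM].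
  rewrite abs_of_real, Rabs_pos_eq by (left; apply exp_pos).
  apply exp_le_monotone.
  assert (A := oscillating_drift _ psi_osc k (Z.of_nat n)).
  apply IZR_le in Hk; apply Rabs_le_between in A; lra. }
destruct (in_space_bmult E m (coord u) M HM Hm (proj2_sig u)) as [B1 B2].
destruct (in_space_shift_iter _ n B1) as [_ S2].
change (space_norm E (coord (orbit T u n)) <= M * space_norm E (coord u)).
replace (coord (orbit T u n)) with
  (fun j => mult (m (j + Z.of_nat n)%Z) (coord u (j + Z.of_nat n)%Z)); [lra|].
extensionality j; rewrite coord_orbit_shift; unfold m; destruct Z_le_dec as [Hk|Hk].
- replace (j + Z.of_nat n - Z.of_nat n)%Z with j by lia; reflexivity.
- rewrite Hu by lia; etransitivity; [|symmetry]; apply (mult_zero_r (K := F)).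
Qed.

Lemma shift_average_positively_expansive : average_positively_expansive T.
Proof.
apply average_positively_expansive_windows; intros x M Hx.
assert (Hk : exists k, coord x k <> zero).
{ apply NNPP; intro H; apply Hx; apply seqs_ext; intro k.
  apply NNPP; intro e; apply H; exists k; exact e. }
destruct Hk as [k Hk]; apply abs_gt_0 in Hk.
assert (Hc : 0 < exp (- (2 * IZR (Z.abs k))) * abs (coord x k))
  by (apply Rmult_lt_0_compat; [apply exp_pos|exact Hk]).
set (c := exp (- (2 * IZR (Z.abs k))) * abs (coord x k)) in *.
apply (holds_on_windows_impl _ _) with (2 := osc_high _ psi_osc (M / c)).
intros n Hn; eapply Rle_trans; [|apply (norm_orbit_shift_ge x k n)].
unfold Rminus; rewrite exp_plus, Rmult_assoc; fold c.
assert (A := exp_ineq1_le (psi (Z.of_nat n))).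
replace M with (M / c * c) by (field; lra).
apply Rmult_le_compat_r; lra.
Qed.

Lemma norm_orbit_supported_small (u : seqs_NormedModule F E) N eps :
  supported N u -> 0 < eps -> exists M, forall n,
  psi (Z.of_nat n) <= M -> norm (orbit T u n) < eps.
Proof.
intros Hu He.
assert (Hd : 0 < norm u + 1) by (assert (A := norm_ge_0 u); lra).
assert (Hq : 0 < eps / (norm u + 1)) by (apply Rdiv_lt_0_compat; lra).
exists (ln (eps / (norm u + 1)) - 2 * IZR N); intros n Hn.
eapply Rle_lt_trans; [apply norm_orbit_shift_le, Hu|].
apply Rle_lt_trans with (eps / (norm u + 1) * norm u).
- apply Rmult_le_compat_r; [apply norm_ge_0|].
  rewrite <- (exp_ln (eps / (norm u + 1))) by exact Hq; apply exp_le_monotone; lra.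
- apply Rlt_le_trans with (eps / (norm u + 1) * (norm u + 1)); [nra|].
  right; field; lra.
Qed.

Lemma shift_distributionally_chaotic : distributionally_chaotic T.
Proof.
destruct (supported_ex (K := F) (E := E)) as [e [He He1]].
apply (distributionally_chaotic_windows T e).
- intro M; apply (holds_on_windows_impl _ _) with (2 := osc_high _ psi_osc M).
  intros n Hn; eapply Rle_trans; [|apply (norm_orbit_shift_ge e 0 n)].
  rewrite He1, abs_one; simpl Z.abs; rewrite Rmult_0_r, Rminus_0_r, Rmult_1_r.
  assert (A := exp_ineq1_le (psi (Z.of_nat n))); lra.
- intros tau Ht; destruct (norm_orbit_supported_small e 0 tau He Ht) as [M HM].
  exact (holds_on_windows_impl _ _ HM (osc_low _ psi_osc M)).
Qed.

(** Since [psi] is even, the inverse of the shift is its conjugate under the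
    reflection; this form gives boundedness and all norm estimates for free. *)
Definition shift_inverse_fun (x : seqs_NormedModule F E) : seqs_NormedModule F E :=
  reflect (T (reflect x)).

Lemma shift_inverse_is_linear : is_linear shift_inverse_fun.
Proof.
apply (is_linear_comp (fun x => T (reflect x)) reflect); [|apply reflect_is_linear].
apply (is_linear_comp reflect T); [apply reflect_is_linear|apply op_is_linear].
Qed.

Definition shift_inverse : operator (seqs_NormedModule F E) :=
  Operator shift_inverse_fun shift_inverse_is_linear.

Lemma reflect_shift_inverse x : reflect (shift_inverse x) = T (reflect x).
Proof. apply reflect_involutive. Qed.

Lemma coord_shift_inverse x j :
  coord (shift_inverse x) j =
  mult (of_real F (exp (psi j - psi (j - 1)%Z))) (coord x (j - 1)%Z).
Proof.
change (coord (shift_inverse x) j) with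
  (mult (potential_weight F psi (- j + 1)%Z) (coord x (- (- j + 1))%Z)).
unfold potential_weight.
replace (- j + 1 - 1)%Z with (- j)%Z by lia.
replace (- j + 1)%Z with (- (j - 1))%Z by lia.
rewrite !(osc_even _ psi_osc), Z.opp_involutive; reflexivity.
Qed.

Lemma shift_inverse_is_inverse : is_inverse T shift_inverse.
Proof.
assert (C : forall a b (y : F), a + b = 0 ->
  mult (of_real F (exp a)) (mult (of_real F (exp b)) y) = y).
{ intros a b y H; rewrite mult_assoc, of_real_mult, <- exp_plus, H, exp_0, of_real_1.
  apply (mult_one_l (K := F)). }
split; intro x; apply seqs_ext; intro j.
- rewrite coord_shift_inverse.
  change (coord (T x) (j - 1)) with
    (mult (potential_weight F psi (j - 1 + 1)%Z) (coord x (j - 1 + 1)%Z)).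
  unfold potential_weight; replace (j - 1 + 1)%Z with j by lia; apply C; ring.
- change (coord (T (shift_inverse x)) j) with
    (mult (potential_weight F psi (j + 1)%Z) (coord (shift_inverse x) (j + 1)%Z)).
  rewrite coord_shift_inverse; unfold potential_weight.
  replace (j + 1 - 1)%Z with j by lia; apply C; ring.
Qed.

(** The vector [u + B_w^{-n} v] goes from near [a] to near [b]; the estimate of
    [B_w^{-n} v] is that of the [n]-th iterate of the reflected vector. *)
Lemma shift_topologically_transitive : topologically_transitive T.
Proof.
intros A B HA HB [a Ha] [b Hb].
destruct (HA a Ha) as [ea Hea]; destruct (HB b Hb) as [eb Heb].
set (eps := Rmin ea eb / 2).
assert (He : 0 < eps).
{ assert (P := Rmin_pos ea eb (cond_pos ea) (cond_pos eb)); unfold eps; lra. }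
destruct (supported_dense a eps He) as [N [u [Hu Hua]]].
destruct (supported_dense b eps He) as [N' [v [Hv Hvb]]].
assert (Hrv : supported N' (reflect v)) by (intros j Hj; apply Hv; lia).
destruct (norm_orbit_supported_small u N eps Hu He) as [M HM].
destruct (norm_orbit_supported_small (reflect v) N' eps Hrv He) as [M' HM'].
destruct (holds_on_windows_ex _ (osc_low _ psi_osc (Rmin M M'))) as [n Hn].
assert (D1 := HM n (Rle_trans _ _ _ Hn (Rmin_l M M'))).
assert (D2 := HM' n (Rle_trans _ _ _ Hn (Rmin_r M M'))).
rewrite <- (conjugate_orbit reflect T shift_inverse reflect_shift_inverse),
  norm_reflect in D2.
set (y := orbit shift_inverse v n) in *.
exists n, (plus u y); split.
- apply Hea, norm_compat1, (norm_minus_plus_lt u y a eps eps); auto.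
  assert (P := Rmin_l ea eb); unfold eps; lra.
- replace (orbit T (plus u y) n) with (plus v (orbit T u n)).
  + apply Heb, norm_compat1, (norm_minus_plus_lt v _ b eps eps); auto.
    assert (P := Rmin_r ea eb); unfold eps; lra.
  + rewrite orbit_plus; unfold y; rewrite (orbit_inverse _ _ shift_inverse_is_inverse).
    apply (plus_comm v).
Qed.

End PotentialShift.

(** * Construction of an oscillating potential *)

Open Scope nat_scope.

(** On the block [r^2 <= i < (r+1)^2] a tent of height [r] starting at 0, above
    the axis for even [r] and below it for odd [r]. *)
Definition zigzag (i : nat) : Z :=
  let r := Nat.sqrt i in
  let t := i - r * r in
  let d := Z.of_nat (Nat.min t (2 * r + 1 - t)) in
  if Nat.even r then d else (- d)%Z.

Lemma zigzag_block (r t : nat) : t <= 2 * r ->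
  zigzag (r * r + t) =
  let d := Z.of_nat (Nat.min t (2 * r + 1 - t)) in
  if Nat.even r then d else (- d)%Z.
Proof.
intro Ht; unfold zigzag.
rewrite (Nat.sqrt_unique (r * r + t) r) by nia.
replace (r * r + t - r * r) with t by lia; reflexivity.
Qed.

Lemma zigzag_step (i : nat) : (Z.abs (zigzag (S i) - zigzag i) <= 1)%Z.
Proof.
assert (Hr := Nat.sqrt_spec i (Nat.le_0_l i)); set (r := Nat.sqrt i) in *.
set (t := i - r * r).
assert (Ht : t <= 2 * r) by (unfold t; nia).
replace i with (r * r + t) by (unfold t; lia).
rewrite (zigzag_block r t Ht); cbv zeta.
destruct (Nat.eq_dec t (2 * r)) as [e|e].
- replace (S (r * r + t)) with (S r * S r + 0) by nia.
  rewrite zigzag_block by lia; cbv zeta.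
  destruct (Nat.even r), (Nat.even (S r)); lia.
- replace (S (r * r + t)) with (r * r + S t) by lia.
  rewrite zigzag_block by lia; cbv zeta.
  destruct (Nat.even r); lia.
Qed.

(** The tent takes its extreme value twice in a row: a window of times meets two
    consecutive values of the double logarithm. *)
Lemma zigzag_peak (r i : nat) : i = r * r + r \/ i = S (r * r + r) -> 0 < r ->
  zigzag i = if Nat.even r then Z.of_nat r else (- Z.of_nat r)%Z.
Proof.
intros [-> | ->] Hr; [|replace (S (r * r + r)) with (r * r + S r) by lia];
  rewrite zigzag_block by lia; cbv zeta; destruct (Nat.even r); lia.
Qed.

Definition profile (n : nat) : Z := zigzag (Nat.log2 (Nat.log2 n)).

(** [log2 (n + 1)] is [log2 n] or [log2 n + 1], so composing with it keeps steps
    bounded by 1. *)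
Lemma profile_step (n : nat) : (Z.abs (profile (S n) - profile n) <= 1)%Z.
Proof.
unfold profile; destruct (Nat.log2_succ_or n) as [-> | ->]; [|lia].
destruct (Nat.log2_succ_or (Nat.log2 n)) as [-> | ->]; [apply zigzag_step|lia].
Qed.

(** Squaring adds 1 to the double logarithm. *)
Lemma profile_window (i n : nat) :
  let m := 2 ^ 2 ^ i in m <= n <= m * m ->
  profile n = zigzag i \/ profile n = zigzag (S i).
Proof.
intros m [H1 H2]; unfold m in *.
apply Nat.log2_le_mono in H1; rewrite Nat.log2_pow2 in H1 by lia.
rewrite <- Nat.pow_add_r in H2.
apply Nat.log2_le_mono in H2; rewrite Nat.log2_pow2 in H2 by lia.
replace (2 ^ i + 2 ^ i) with (2 ^ S i) in H2 by (simpl; lia).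
apply Nat.log2_le_mono in H1, H2; rewrite Nat.log2_pow2 in H1, H2 by lia.
unfold profile; set (l := Nat.log2 (Nat.log2 n)) in *.
assert (D : l = i \/ l = S i) by lia.
destruct D as [-> | ->]; auto.
Qed.

Lemma profile_on_windows (r : nat) : 0 < r ->
  exists m, r <= m /\ forall n, m <= n <= m * m ->
    profile n = if Nat.even r then Z.of_nat r else (- Z.of_nat r)%Z.
Proof.
intro Hr; set (i := r * r + r); exists (2 ^ 2 ^ i); split.
- assert (A := Nat.pow_gt_lin_r 2 i ltac:(lia)).
  assert (B := Nat.pow_gt_lin_r 2 (2 ^ i) ltac:(lia)).
  unfold i in *; nia.
- intros n Hn; destruct (profile_window i n Hn) as [-> | ->];
    apply zigzag_peak; unfold i; auto.
Qed.

Open Scope R_scope.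

Lemma oscillating_exists : exists psi, oscillating psi.
Proof.
exists (fun j => IZR (profile (Z.abs_nat j))); split.
- reflexivity.
- intro j; f_equal; f_equal; lia.
- intro j; rewrite <- minus_IZR, <- abs_IZR; apply IZR_le.
  destruct (Z_le_dec 0 j) as [Hj|Hj].
  + replace (Z.abs_nat (j + 1)) with (S (Z.abs_nat j)) by lia; apply profile_step.
  + replace (Z.abs_nat j) with (S (Z.abs_nat (j + 1))) by lia.
    rewrite <- Z.abs_opp, Z.opp_sub_distr, Z.add_comm; apply profile_step.
- intros M m0; destruct (INR_unbounded M) as [k Hk].
  destruct (profile_on_windows (2 * (S (m0 + k)))%nat ltac:(lia)) as [m [Hm H]].
  exists m; split; [lia|]; intros n Hn; rewrite Zabs2Nat.id, H by exact Hn.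
  rewrite Nat.even_even; rewrite <- INR_IZR_INZ.
  left; eapply Rlt_le_trans; [exact Hk|apply le_INR; lia].
- intros M m0; destruct (INR_unbounded (- M)) as [k Hk].
  destruct (profile_on_windows (2 * (m0 + k) + 1)%nat ltac:(lia)) as [m [Hm H]].
  exists m; split; [lia|]; intros n Hn; rewrite Zabs2Nat.id, H by exact Hn.
  rewrite Nat.even_odd, opp_IZR, <- INR_IZR_INZ.
  assert (INR k <= INR (2 * (m0 + k) + 1)) by (apply le_INR; lia); lra.
Qed.

Theorem theorem9 (F : scalar_field) (E : seqspace) :
  exists (w : Z -> F) (Hw : bounded_weight w),
    Rbar_lt 0 (Glb_Rbar (fun r => exists j : Z, r = abs (w j))) /\
    exists S : operator (seqs_NormedModule F E),
      is_inverse (backward_shift E w Hw) S /\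
      topologically_transitive (backward_shift E w Hw) /\
      average_positively_expansive (backward_shift E w Hw) /\
      average_positively_expansive S /\
      distributionally_chaotic (backward_shift E w Hw) /\
      distributionally_chaotic S.
Proof.
destruct oscillating_exists as [psi Hpsi].
exists (potential_weight F psi), (potential_weight_bounded Hpsi).
split; [apply potential_weight_bounded_below, Hpsi|].
exists (shift_inverse Hpsi).
split; [apply shift_inverse_is_inverse|].
split; [apply shift_topologically_transitive|].
assert (A := shift_average_positively_expansive (F := F) (E := E) Hpsi).
assert (D := shift_distributionally_chaotic (F := F) (E := E) Hpsi).
assert (C := reflect_shift_inverse (F := F) (E := E) Hpsi).
split; [exact A|split; [|split; [exact D|]]].
- exact (average_positively_expansive_conjugate _ _ _ reflect_is_linear
           reflect_involutive norm_reflect C A).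
- exact (distributionally_chaotic_conjugate _ _ _ reflect_is_linear
           reflect_involutive norm_reflect C D).
Qed.
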